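(* Let $p,q$ be nonnegative integers and let $\mathsf{C}_{p,q}$ be the real Clifford algebra of signature $(p,q)$ with its involution $*$ determined by $e_i^*=e_i$ for $1\le i\le p$ and $e_i^*=-e_i$ for $p+1\le i\le p+q$. Then its polarization constant is the scalar (multiple of the identity) $$\kappa(\mathsf{C}_{p,q})=\frac{1}{1+2^{-\frac{p+q-1}{2}}\cos\left(\frac{p-q-1}{4}\pi\right)} .$$
   Context: $\mathsf{C}_{p,q}$ is the unital associative $\mathbb{R}$-algebra of dimension $2^{p+q}$ generated by elements $e_1,\dots,e_{p+q}$ satisfying $e_i^2=1$ for $1\le i\le p$, $e_j^2=-1$ for $p+1\le j\le p+q$, and $e_ie_j=-e_je_i$ for $i\ne j$. A $*$-algebra $(\mathfrak{A},* )$ is a finite-dimensional unital associative algebra over $\mathbb{R}$ equipped with an $\mathbb{R}$-linear map (involution) $\alpha\mapsto\alpha^*$ satisfying $(\alpha\beta)^*=\beta^*\alpha^*$ and $(\alpha^* )^*=\alpha$, with its natural topology as a finite-dimensional real vector space. Its unitary group is $\Gamma(\mathfrak{A},* )=\{u\in\mathfrak{A}: uu^*=1_{\mathfrak{A}}\}$. A closed subgroup $G\subset\Gamma(\mathfrak{A},* )$ generates $\mathfrak{A}$ if $\mathfrak{A}$ is the smallest $*$-subalgebra containing $G$ (equivalently, $\mathrm{span}_{\mathbb{R}}G=\mathfrak{A}$). $(\mathfrak{A},* )$ is polarizable if $\Gamma(\mathfrak{A},* )$ is compact and generates $\mathfrak{A}$; $(\mathsf{C}_{p,q},* )$ is polarizable.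 A compact subgroup $G\subset\Gamma(\mathfrak{A},* )$ is polarizing if it generates $\mathfrak{A}$ and $\int_G g\,dg=0$ (normalized Haar measure). A Hermitian form on a left $\mathfrak{A}$-module $\mathsf{X}$ is a map $Q:\mathsf{X}\times\mathsf{X}\to\mathfrak{A}$ that is additive and left $\mathfrak{A}$-linear in the first argument and satisfies $Q(x,y)^*=Q(y,x)$. The polarization constant of a polarizable $*$-algebra $(\mathfrak{A},* )$ is the element $\kappa=\kappa(\mathfrak{A},* )\in\mathfrak{A}$ such that $Q(x,y)=\kappa\int_G Q(x+gy,x+gy)\,g\,dg$ for every left $\mathfrak{A}$-module $\mathsf{X}$, every Hermitian form $Q$ on $\mathsf{X}$, every polarizing subgroup $G\subset\Gamma(\mathfrak{A},* )$ and all $x,y\in\mathsf{X}$; such an element exists. *)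

(* Defs.v *)
From HB Require Import structures.
From mathcomp Require Import all_boot all_order all_algebra all_field.
From mathcomp Require Import all_classical all_reals all_analysis.
Set Implicit Arguments.
Unset Strict Implicit.
Unset Printing Implicit Defensive.
Import Order.TTheory GRing.Theory Num.Theory.
Import numFieldNormedType.Exports.
Local Open Scope classical_set_scope.
Local Open Scope ring_scope.

(* The topology of a finite-dimensional real vector space is pulled back from
   R^n along the coordinates in a basis; it does not depend on the basis. *)

Definition coords (R : realType) (A : falgType R) (a : A) :
  'rV[R]_(\dim {:A}) := \row_i coord (vbasis {:A}) i a.

Definition natural (R : realType) (A : falgType R) : Type :=
  initial_topology (@coords R A).

HB.instance Definition _ (R : realType) (A : falgType R) :=
  Topological.copy (natural A) (initial_topology (@coords R A)).
HB.instance Definition _ (R : realType) (A : falgType R) :=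
  isPointed.Build (natural A) (0 : A).

Notation borel A := (g_sigma_algebraType (@open (natural A))).

Definition vintegral (R : realType) (A : falgType R)
    (mu : probability (borel A) R) (G : set A) (f : A -> A) : A :=
  \sum_(i < \dim {:A})
    (\int[mu]_(g in (G : set (borel A))) coord (vbasis {:A}) i (f g))
      *: (vbasis {:A})`_i.

Record involution (R : realType) (A : falgType R) (star : A -> A) : Prop := {
  involution_linear : linear star;
  involutionM : forall a b, star (a * b) = star b * star a;
  involutionK : forall a, star (star a) = a }.

Definition unitary (R : realType) (A : falgType R) (star : A -> A) : set A :=
  [set u | u * star u = 1].

(* Elements of unitary star are units of A, so g^-1 is a genuine inverse. *)
Record unitary_subgroup (R : realType) (A : falgType R) (star : A -> A)
    (G : set A) : Prop := {
  unitary_subgroup_sub : G `<=` unitary star;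
  unitary_subgroup1 : G 1;
  unitary_subgroupM : forall g h, G g -> G h -> G (g * h);
  unitary_subgroupV : forall g, G g -> G g^-1 }.

Definition star_subalgebra (R : realType) (A : falgType R) (star : A -> A)
    (U : {vspace A}) : Prop :=
  [/\ 1 \in U,
      forall a b, a \in U -> b \in U -> a * b \in U &
      forall a, a \in U -> star a \in U].

Definition generates (R : realType) (A : falgType R) (star : A -> A)
    (G : set A) : Prop :=
  forall U : {vspace A}, star_subalgebra star U ->
    (forall g, G g -> g \in U) -> U = fullv.

Definition polarizable (R : realType) (A : falgType R) (star : A -> A) : Prop :=
  compact (unitary star : set (natural A)) /\ generates star (unitary star).

(* The normalized Haar measure of a compact subgroup G, seen as a Borel
   probability measure on A carried by G. *)
Record is_haar (R : realType) (A : falgType R) (G : set A)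
    (mu : probability (borel A) R) : Prop := {
  is_haar_carried : mu G = 1%E;
  is_haar_invariant : forall (g : A) (B : set (borel A)), G g -> measurable B ->
    mu ((fun h : A => g * h) @^-1` B) = mu B }.

(* G is a polarizing subgroup, with normalized Haar measure mu. *)
Record polarizing (R : realType) (A : falgType R) (star : A -> A)
    (G : set A) (mu : probability (borel A) R) : Prop := {
  polarizing_subgroup : unitary_subgroup star G;
  polarizing_compact : compact (G : set (natural A));
  polarizing_generates : generates star G;
  polarizing_haar : is_haar G mu;
  polarizing_mean0 : vintegral mu G (fun g => g) = 0 }.

Record hermitian_form (R : realType) (A : falgType R) (star : A -> A)
    (X : lmodType A) (Q : X -> X -> A) : Prop := {
  hermitian_formD : forall x y z, Q (x + y) z = Q x z + Q y z;
  hermitian_formZ : forall a x y, Q (a *: x) y = a * Q x y;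
  hermitian_form_star : forall x y, star (Q x y) = Q y x }.

Definition is_polarization_constant (R : realType) (A : falgType R)
    (star : A -> A) (kappa : A) : Prop :=
  polarizable star /\
  forall (X : lmodType A) (Q : X -> X -> A) (G : set A)
      (mu : probability (borel A) R),
    hermitian_form star Q -> polarizing star G mu ->
    forall x y : X,
      Q x y =
        kappa * vintegral mu G (fun g => Q (x + g *: y) (x + g *: y) * g).

(* The generators e_1, ..., e_(p+q) are indexed from 0; the first p have
   square 1. *)
Record is_clifford (R : realType) (p q : nat) (A : falgType R)
    (e : 'I_(p + q) -> A) : Prop := {
  clifford_dim : \dim {:A} = (2 ^ (p + q))%N;
  clifford_generated : <<1 & codom e>>%VS = fullv;
  clifford_sqr_pos : forall i : 'I_(p + q), (i < p)%N -> e i ^+ 2 = 1;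
  clifford_sqr_neg : forall i : 'I_(p + q), (p <= i)%N -> e i ^+ 2 = -1;
  clifford_anticomm : forall i j, i != j -> e i * e j = - (e j * e i) }.

Record clifford_involution (R : realType) (p q : nat) (A : falgType R)
    (e : 'I_(p + q) -> A) (star : A -> A) : Prop := {
  clifford_involution_inv : involution star;
  clifford_involution_pos : forall i : 'I_(p + q), (i < p)%N -> star (e i) = e i;
  clifford_involution_neg : forall i : 'I_(p + q), (p <= i)%N -> star (e i) = - e i }.

(* Main.v *)
From HB Require Import structures.
Require Import Defs.
From mathcomp Require Import all_boot all_order all_algebra all_field.
From mathcomp Require Import all_classical all_reals all_analysis.
From mathcomp Require Import measurable_realfun ring lra.
Import Order.TTheory GRing.Theory Num.Theory.
Import numFieldNormedType.Exports.
Local Open Scope classical_set_scope.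
Local Open Scope ring_scope.
Set Implicit Arguments.
Unset Strict Implicit.
Unset Printing Implicit Defensive.

(** For unitary [g], the product [Q (x + g y, x + g y) g] expands to
    [Q(x,x) g + Q(x,y) + g Q(y,x) g + g Q(y,y)].  The identity function has mean
    zero over a polarizing group, so the first and last terms average to zero and
    the average is [Q(x,y) + T(Q(y,x))], where [T a] is the average of [g a g].
    The point is that [T a = c a^*] for a real number [c] which depends on the
    signature only; since [Q(y,x)^* = Q(x,y)], the average is [(1 + c) Q(x,y)].

    To find [c], compare [G] with the blades: the products of generators in
    increasing order, one for each of the [2^n] sets of generators, [n = p + q].
    Up to sign they are permuted by left multiplication by a generator, so a sum
    over blades of the values of an even function is translation invariant
    ([sum_even_blade]).  Applied to [w |-> w a w], this gives
    [\sum_w w a w = C a^*] with [C = \sum_w w^2] ([sum_blade_sandwich]).  Likewise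
    invariance of the Haar measure gives [T (a h) = h^* T a], first for [h] in
    [G] and then for all [h], because [G] spans the algebra ([haar_sandwichM]).
    Hence [T a = w T (a w)] for each blade [w]; summing over [w] inside the
    integral turns the integrand into the constant [C a^*], so that
    [T a = C / 2^n a^*] ([haar_sandwichE]).

    The number [C] comes from a recurrence.  Let [M] be the sum of the [w^2] with
    sign [-1] for blades of odd degree.  Adjoining a generator of square [eps]
    multiplies [C + i M] by [1 - i eps], and [C + i M = 1 + i] without generators.
    So [C] is the real part of [(1 + i)^(q+1) (1 - i)^p], that is
    [sqrt 2 ^ (n+1) cos ((p - q - 1) pi / 4)] ([sum_blade_sqr]).  It exceeds
    [- 2^n] ([blade_square_sum_bounds]), which makes [1 + c] invertible.

    Compactness of the unitary group follows from an inner product, summed over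
    the blades, for which right multiplications by [m] and by [m^*] are adjoint:
    unitaries then lie on a sphere ([unitary_coord_bounded]).  Conversely, a
    polarization constant is determined by one nonzero instance of its defining
    identity; the signed blades with the uniform measure are polarizing
    ([signed_blades_polarizing]), and the form [x y^*] at [x = y = 1] gives
    [1 = kappa (1 + c)]. *)

(** * Induction along linear spans and generated algebras *)

(** In finite dimension a left multiplication which is injective is onto. *)
Lemma mulr1_left (R : realType) (A : falgType R) (u v : A) :
  u * v = 1 -> v * u = 1.
Proof.
move=> uv1; pose f := amull v.
have kf : lker f == 0%VS.
  apply/lker0P => x y; rewrite !lfunE/= => vxy.
  by rewrite -[x]mul1r -[y]mul1r -uv1 -!mulrA vxy.
have vw1 : v * (f^-1%VF 1) = 1.
  by rewrite -[RHS](lker0_lfunVK kf) lfunE.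
by have := congr1 ( *%R u) vw1; rewrite mulrA uv1 mul1r mulr1 => <-.
Qed.

Definition linear_closed_pred (R : realType) (V : vectType R)
    (P : V -> Prop) : Prop :=
  P 0 /\ forall k u v, P u -> P v -> P (k *: u + v).

(** A subspace of maximal dimension among those on which [P] holds must contain
    every vector satisfying [P]. *)
Lemma vspace_of_pred (R : realType) (V : vectType R) (P : V -> Prop) :
  linear_closed_pred P -> exists U : {vspace V}, forall v, v \in U <-> P v.
Proof.
move=> [P0 PD].
pose good d := `[< exists2 U : {vspace V}, \dim U = d & forall v, v \in U -> P v >].
have good0 : exists d, good d.
  by exists 0%N; apply/asboolP; exists 0%VS; rewrite ?dimv0// => v /[!memv0]/eqP ->.
have goodle d : good d -> (d <= \dim {:V})%N.
  by move=> /asboolP[U <- _]; exact/dimvS/subvf.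
case: (ex_maxnP good0 goodle) => d /asboolP[U dU PU] dmax.
exists U => v; split=> [|Pv]; first exact: PU.
have : good (\dim (U + <[v]>)).
  apply/asboolP; exists (U + <[v]>)%VS => // w /memv_addP[u uU [_ /vlineP[k ->] ->]].
  by rewrite addrC; apply: PD => //; exact: PU.
move=> /dmax; rewrite -dU => le_dim.
have/eqP -> : U == (U + <[v]>)%VS by rewrite eqEdim addvSl.
by apply: (subvP (addvSr _ _)); exact: memv_line.
Qed.

Lemma generated_algebra_ind (R : realType) (A : falgType R) (s : seq A)
    (P : A -> Prop) :
  <<1 & s>>%VS = fullv -> linear_closed_pred P -> P 1 ->
  (forall a b, P a -> P b -> P (a * b)) -> {in s, forall x, P x} ->
  forall a, P a.
Proof.
move=> sA Plin P1 PM Ps a; have [U UP] := vspace_of_pred Plin.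
apply/UP/(subvP _ _ (memvf a)); rewrite -sA.
have sub1 : (1 <= U)%VS by rewrite -memvE; exact/UP.
apply: agenv_sub_modl => //; apply/prodvP => u v uU /UP Pv.
apply/UP/PM => //; apply/UP; apply: (subvP _ _ uU).
rewrite subv_add sub1/=; apply/span_subvP => x /Ps; exact: (UP _).2.
Qed.

(** A group of unitaries is closed under products and under the involution, which
    is inversion on it; so its linear span is already a star-subalgebra.  The span
    is the impredicative intersection of all linear properties of the group. *)
Lemma generates_ind (R : realType) (A : falgType R) (star : A -> A)
    (G : set A) (P : A -> Prop) :
  involution star -> unitary_subgroup star G -> generates star G ->
  linear_closed_pred P -> (forall g, G g -> P g) -> forall a, P a.
Proof.
move=> [starL starM starK] [GU G1 GM GV] gen Plin PG.
pose spanG a := forall Q : A -> Prop,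
  linear_closed_pred Q -> (forall g, G g -> Q g) -> Q a.
have lspanG : linear_closed_pred spanG.
  split=> [Q [Q0 _] _ //|k u v su sv Q lQ QG].
  by apply: lQ.2; [exact: su | exact: sv].
have spanGM a b : spanG a -> spanG b -> spanG (a * b).
  move=> sa sb; apply: (sa (fun a => spanG (a * b))) => [|g Gg].
    split=> [|k u v su sv]; first by rewrite mul0r; exact: lspanG.1.
    by rewrite mulrDl -scalerAl; exact: lspanG.2.
  apply: (sb (fun b => spanG (g * b))) => [|h Gh].
    split=> [|k u v su sv]; first by rewrite mulr0; exact: lspanG.1.
    by rewrite mulrDr -scalerAr; exact: lspanG.2.
  by move=> Q _; apply; exact: GM.
have star0 : star 0 = 0.
  by have := starL (-1) 0 0; rewrite scaler0 addr0 scaleN1r addNr.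
have spanGV a : spanG a -> spanG (star a).
  move=> sa; apply: (sa (fun a => spanG (star a))) => [|g Gg].
    split=> [|k u v su sv]; first by rewrite star0; exact: lspanG.1.
    by rewrite starL; exact: lspanG.2.
  move=> Q _; apply; have gg := GU _ Gg; rewrite /unitary/= in gg.
  suff -> : star g = g^-1 by exact: GV.
  have ug : g \is a GRing.unit.
    by apply/unitrP; exists (star g); split=> //; exact: mulr1_left.
  by rewrite -[RHS]mulr1 -gg mulKr.
have [U UP] := vspace_of_pred lspanG.
have UA : U = fullv.
  apply: gen => [|g Gg]; last by apply/UP => Q _ QG; exact: QG.
  split=> [|a b /UP sa /UP sb|a /UP sa]; apply/UP.
  - by move=> Q _ QG; exact: QG.
  - exact: spanGM.
  - exact: spanGV.
move=> a; have /UP : a \in U by rewrite UA memvf.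
exact.
Qed.

Lemma generates_of_generators (R : realType) (A : falgType R) (star : A -> A)
    (s : seq A) (G : set A) :
  <<1 & s>>%VS = fullv -> {in s, forall x, G x} -> generates star G.
Proof.
move=> sgen sG U [U1 UM _] GU.
apply/eqP; rewrite eqEsubv subvf/=; apply/subvP => a _.
move: a; apply: (generated_algebra_ind sgen) => // [|x /sG].
  by split=> [|k u v uU vU]; rewrite ?mem0v// rpredD// rpredZ.
exact: GU.
Qed.

Lemma oner_neqN1 (R : realType) (A : falgType R) : (1 == -1 :> A) = false.
Proof.
apply/negbTE; rewrite -subr_eq0 opprK -[1]scale1r -scalerDl scaler_eq0.
by rewrite oner_eq0 orbF lt0r_neq0//; lra.
Qed.

(** * Blades *)

(** Defined by recursion so that sums over blades satisfy a recurrence when one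
    generator is added. *)
Fixpoint sublists (T : Type) (s : seq T) : seq (seq T) :=
  if s is x :: s' then sublists s' ++ [seq x :: t | t <- sublists s']
  else [:: [::]].

Definition blade (A : pzRingType) (t : seq A) : A := \prod_(x <- t) x.

(** For a quadratic form with values 1 and -1, these are the relations between
    the vectors of an orthonormal basis in its Clifford algebra. *)
Record orthonormal_family (A : nzRingType) (s : seq A) : Prop := {
  orthonormal_sqr : {in s, forall x, x * x = 1 \/ x * x = -1};
  orthonormal_anticomm : pairwise (fun x y => x * y == - (y * x)) s }.

Lemma size_sublists (T : Type) (s : seq T) : size (sublists s) = (2 ^ size s)%N.
Proof.
by elim: s => //= x s IH; rewrite size_cat size_map IH addnn -mul2n expnS.
Qed.

Lemma big_sublists_cons (T : Type) (V : nmodType) (f : seq T -> V) x s :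
  \sum_(t <- sublists (x :: s)) f t =
  \sum_(t <- sublists s) f t + \sum_(t <- sublists s) f (x :: t).
Proof. by rewrite /= big_cat big_map. Qed.

Lemma blade_cons (A : pzRingType) (x : A) t : blade (x :: t) = x * blade t.
Proof. by rewrite /blade big_cons. Qed.

Lemma blade_nil (A : pzRingType) : blade [::] = 1 :> A.
Proof. by rewrite /blade big_nil. Qed.

Lemma orthonormal_cons (A : nzRingType) (x : A) s : orthonormal_family (x :: s) ->
  [/\ x * x = 1 \/ x * x = -1, {in s, forall y, y * x = - (x * y)} &
      orthonormal_family s].
Proof.
move=> [sq]; rewrite pairwise_cons => /andP[/allP anti pw]; split.
- by apply: sq; rewrite mem_head.
- by move=> y /anti /eqP ->; rewrite opprK.
- by split=> // y ys; apply: sq; rewrite inE ys orbT.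
Qed.

(** Left multiplication by the generator [x] permutes the blades up to sign: it
    exchanges those with and without the factor [x], and [x] can be moved past
    the other generators at the cost of a sign. *)
Lemma sum_even_blade (A : nzRingType) (V : nmodType) (s : seq A) (f : A -> V) x :
  orthonormal_family s -> x \in s -> (forall a, f (- a) = f a) ->
  \sum_(t <- sublists s) f (x * blade t) = \sum_(t <- sublists s) f (blade t).
Proof.
elim: s f => // y s IH f /orthonormal_cons[yy anti os] + f_even.
have consE (h : A -> V) : \sum_(t <- sublists (y :: s)) h (blade t) =
    \sum_(t <- sublists s) h (blade t) + \sum_(t <- sublists s) h (y * blade t).
  rewrite big_sublists_cons; congr (_ + _).
  by apply: eq_bigr => t _; rewrite blade_cons.
rewrite inE (consE f) (consE (fun b => f (x * b))) => /orP[/eqP -> | xs].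
  rewrite addrC; congr (_ + _); apply: eq_bigr => t _; rewrite mulrA.
  by case: yy => ->; rewrite ?mulN1r ?f_even ?mul1r.
rewrite IH//; congr (_ + _).
rewrite -(IH (fun b => f (y * b)))//; last by move=> a; rewrite mulrN f_even.
by apply: eq_bigr => t _; rewrite !mulrA (anti x xs) mulNr f_even.
Qed.

Lemma mul_generator_blade (A : nzRingType) (s : seq A) x t :
  orthonormal_family s -> x \in s -> t \in sublists s ->
  exists2 t', t' \in sublists s & x * blade t = blade t' \/ x * blade t = - blade t'.
Proof.
elim: s t => // y s IH t /orthonormal_cons[yy anti os].
rewrite inE /= mem_cat => /orP[/eqP ->|xs] /orP[ts|/mapP[u us ->]].
- exists (y :: t); last by left; rewrite blade_cons.
  by rewrite mem_cat map_f ?orbT.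
- exists u; first by rewrite mem_cat us.
  by rewrite blade_cons mulrA; case: yy => ->; [left|right]; rewrite ?mulN1r ?mul1r.
- have [t' t's tE] := IH _ os xs ts.
  by exists t' => //; rewrite mem_cat t's.
- have [t' t's tE] := IH _ os xs us.
  exists (y :: t'); first by rewrite mem_cat map_f ?orbT.
  rewrite !blade_cons mulrA anti// mulNr -mulrA.
  by case: tE => ->; [right|left]; rewrite ?mulrN ?opprK.
Qed.

Lemma mem_sublists (T : eqType) (s t : seq T) :
  t \in sublists s -> {subset t <= s}.
Proof.
elim: s t => [|x s IH] t; first by rewrite inE => /eqP ->.
rewrite /= mem_cat => /orP[/IH ts y /ts|/mapP[u /IH us -> y]].
  by rewrite inE => ->; rewrite orbT.
by rewrite !inE => /orP[->//|/us ->]; rewrite orbT.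
Qed.

(** * The sum of the squares of the blades *)

Lemma sqrt2_cos_pi4 (R : realType) : Num.sqrt 2 * cos (pi / 4) = 1 :> R.
Proof.
have cp : 0 < cos (pi / 4) :> R.
  by apply: cos_gt0_pihalf; have := pi_gt0 R; lra.
have sc : sin (pi / 4) = cos (pi / 4) :> R.
  have /eqP := tan_piquarter R; rewrite /tan.
  by rewrite -(inj_eq (mulIf (lt0r_neq0 cp))) divfK ?lt0r_neq0// mul1r => /eqP.
have := cos2Dsin2 (pi / 4 : R); rewrite sc => c1.
apply/eqP; rewrite -(@eqrXn2 _ 2)// ?mulr_ge0 ?sqrtr_ge0 ?(ltW cp)//.
by rewrite exprMn sqr_sqrtr// expr1n; apply/eqP; lra.
Qed.

Lemma sqrt2_sin_pi4 (R : realType) : Num.sqrt 2 * sin (pi / 4) = 1 :> R.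
Proof.
rewrite -[in X in sin X](_ : - (pi / 4) + pi / 2 = pi / 4 :> R); last by lra.
by rewrite sinDpihalf cosN sqrt2_cos_pi4.
Qed.

(** With [a] generators of square 1 and [b] of square -1, this is the sum of the
    squares of the blades: the real part of [(1 + i)^(b+1) (1 - i)^a]. *)
Definition blade_square_sum (R : realType) (a b : nat) : R :=
  Num.sqrt 2 ^+ (a + b).+1 * cos ((a%:R - b%:R - 1) / 4 * pi).

(** The imaginary part of the same number: the sum of the squares of the blades,
    those of odd degree being counted with a minus sign. *)
Definition blade_square_altsum (R : realType) (a b : nat) : R :=
  - (Num.sqrt 2 ^+ (a + b).+1 * sin ((a%:R - b%:R - 1) / 4 * pi)).

Lemma blade_square_sum0 (R : realType) : blade_square_sum R 0 0 = 1.
Proof.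
rewrite /blade_square_sum expr1.
rewrite (_ : _ * pi = - (pi / 4)); last by rewrite !subrr; lra.
by rewrite cosN sqrt2_cos_pi4.
Qed.

Lemma blade_square_altsum0 (R : realType) : blade_square_altsum R 0 0 = 1.
Proof.
rewrite /blade_square_altsum expr1.
rewrite (_ : _ * pi = - (pi / 4)); last by rewrite !subrr; lra.
by rewrite sinN mulrN opprK sqrt2_sin_pi4.
Qed.

(** Since [sqrt 2 cos (pi/4) = sqrt 2 sin (pi/4) = 1], a further generator
    multiplies the modulus by [sqrt 2] and turns the angle by [pi/4] up or down. *)
Section angle_step.
Variable R : realType.
Let r : R := Num.sqrt 2.
Let c := cos (pi / 4 : R).
Let s := sin (pi / 4 : R).
Let rc : r * c = 1. Proof. exact: sqrt2_cos_pi4. Qed.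
Let rs : r * s = 1. Proof. exact: sqrt2_sin_pi4. Qed.

Let angleSl (a b : nat) : (a.+1%:R - b%:R - 1) / 4 * pi =
  (a%:R - b%:R - 1) / 4 * pi + pi / 4 :> R.
Proof. by rewrite -natr1; lra. Qed.

Let angleSr (a b : nat) : (a%:R - b.+1%:R - 1) / 4 * pi =
  (a%:R - b%:R - 1) / 4 * pi - pi / 4 :> R.
Proof. by rewrite -natr1; lra. Qed.

Lemma blade_square_sumSl a b :
  blade_square_sum R a.+1 b = blade_square_sum R a b + blade_square_altsum R a b.
Proof.
rewrite /blade_square_sum /blade_square_altsum addSn exprSr -/r angleSl.
set x := _ / 4 * pi; rewrite cosD -/c -/s.
transitivity (r ^+ (a + b).+1 * (cos x * (r * c) - sin x * (r * s))); first by ring.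
by rewrite rc rs; ring.
Qed.

Lemma blade_square_altsumSl a b :
  blade_square_altsum R a.+1 b = blade_square_altsum R a b - blade_square_sum R a b.
Proof.
rewrite /blade_square_sum /blade_square_altsum addSn exprSr -/r angleSl.
set x := _ / 4 * pi; rewrite sinD -/c -/s.
transitivity (- (r ^+ (a + b).+1 * (sin x * (r * c) + cos x * (r * s)))); first by ring.
by rewrite rc rs; ring.
Qed.

Lemma blade_square_sumSr a b :
  blade_square_sum R a b.+1 = blade_square_sum R a b - blade_square_altsum R a b.
Proof.
rewrite /blade_square_sum /blade_square_altsum addnS exprSr -/r angleSr.
set x := _ / 4 * pi; rewrite cosB -/c -/s.
transitivity (r ^+ (a + b).+1 * (cos x * (r * c) + sin x * (r * s))); first by ring.
by rewrite rc rs; ring.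
Qed.

Lemma blade_square_altsumSr a b :
  blade_square_altsum R a b.+1 = blade_square_altsum R a b + blade_square_sum R a b.
Proof.
rewrite /blade_square_sum /blade_square_altsum addnS exprSr -/r angleSr.
set x := _ / 4 * pi; rewrite sinB -/c -/s.
transitivity (- (r ^+ (a + b).+1 * (sin x * (r * c) - cos x * (r * s)))); first by ring.
by rewrite rc rs; ring.
Qed.

End angle_step.

(** The sum of squares has [2 ^ (a + b)] terms equal to 1 or -1, and the empty blade
    contributes 1; this is what keeps it strictly above [- 2 ^ (a + b)].  The two
    other bounds carry the induction. *)
Lemma blade_square_sum_bounds (R : realType) (a b : nat) :
  [/\ - 2 ^+ (a + b) < blade_square_sum R a b,
      blade_square_sum R a b <= 2 ^+ (a + b) &
      `|blade_square_altsum R a b| <= 2 ^+ (a + b)].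
Proof.
elim: a => [|a IH].
  elim: b => [|b [IH1 IH2 IH3]].
    by rewrite blade_square_sum0 blade_square_altsum0 expr0 normr1; split; lra.
  move: IH1 IH2 IH3; rewrite blade_square_sumSr blade_square_altsumSr addnS exprS.
  by rewrite !ler_norml => ? ? /andP[? ?]; split; [lra|lra|apply/andP; split; lra].
move: IH => [IH1 IH2 IH3].
move: IH1 IH2 IH3; rewrite blade_square_sumSl blade_square_altsumSl addSn exprS.
by rewrite !ler_norml => ? ? /andP[? ?]; split; [lra|lra|apply/andP; split; lra].
Qed.

Lemma blade_comm (A : nzRingType) (x : A) t :
  {in t, forall y, y * x = - (x * y)} -> blade t * x = (-1) ^+ size t * (x * blade t).
Proof.
elim: t => [|y t IH] anti; first by rewrite blade_nil mulr1 !mul1r.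
rewrite blade_cons -mulrA IH; last first.
  by move=> z zt; apply: anti; rewrite inE zt orbT.
rewrite /= exprS -[(-1) ^+ size t]signr_odd.
have yxB : y * (x * blade t) = - (x * (y * blade t)).
  by rewrite !mulrA anti ?mem_head// mulNr.
by case: odd; rewrite ?expr0 ?expr1 ?mulr1 !(mulN1r, mul1r, mulrN, mulNr, opprK) yxB
  ?opprK.
Qed.

(** Moving [x] past a blade [w] of degree [k] gives [(x w)^2 = (-1)^k x^2 w^2]; so
    the plain and the alternating sum of squares feed each other when [x] is
    added to the generators. *)
Lemma sum_blade_sqr (R : realType) (A : falgType R) (s : seq A) :
  orthonormal_family s ->
  let a := count (fun x => x * x == 1) s in
  let b := count (fun x => x * x == -1) s in
  \sum_(t <- sublists s) blade t * blade t = (blade_square_sum R a b)%:A /\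
  \sum_(t <- sublists s) (-1) ^+ size t * (blade t * blade t) =
    (blade_square_altsum R a b)%:A.
Proof.
elim: s => [_|x s IH /orthonormal_cons[xx anti os]] /=.
  rewrite !big_seq1 blade_nil expr0 !mulr1.
  by rewrite blade_square_sum0 blade_square_altsum0 scale1r.
have [IH1 IH2] := IH os.
rewrite !big_sublists_cons IH1 IH2.
have sqE t : t \in sublists s -> blade (x :: t) * blade (x :: t) =
    (-1) ^+ size t * (x * x) * (blade t * blade t).
  move=> ts; rewrite blade_cons -!mulrA (mulrA (blade t)) blade_comm; last first.
    by move=> y /(mem_sublists ts); exact: anti.
  rewrite -!mulrA -signr_odd.
  by case: odd; rewrite ?expr0 ?expr1 ?(mulN1r, mul1r, mulrN, mulNr, opprK).
have neq1 := oner_neqN1 A.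
have {sqE} [-> ->] :
    \sum_(t <- sublists s) blade (x :: t) * blade (x :: t) =
      (x * x) * (blade_square_altsum R (count (fun x => x * x == 1) s)
         (count (fun x => x * x == -1) s))%:A /\
    \sum_(t <- sublists s) (-1) ^+ size (x :: t) * (blade (x :: t) * blade (x :: t)) =
      - ((x * x) * (blade_square_sum R (count (fun x => x * x == 1) s)
         (count (fun x => x * x == -1) s))%:A).
  rewrite -IH1 -IH2 !mulr_sumr -sumrN big_seq [RHS]big_seq.
  split.
    apply: eq_bigr => t ts; rewrite (sqE t ts).
    by rewrite -signr_odd; case: odd; case: xx => ->;
      rewrite ?expr0 ?expr1 !(mulN1r, mul1r, mulr1, mulrN, mulNr, opprK).
  rewrite big_seq [RHS]big_seq; apply: eq_bigr => t ts; rewrite (sqE t ts) /= exprS.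
  by rewrite -signr_odd; case: odd; case: xx => ->;
    rewrite ?expr0 ?expr1 !(mulN1r, mul1r, mulr1, mulrN, mulNr, opprK).
case: xx => ->; rewrite !eqxx ?neq1 1?eq_sym ?neq1 ?add0n ?add1n.
  by rewrite blade_square_sumSl blade_square_altsumSl scalerDl scalerBl !mul1r.
rewrite blade_square_sumSr blade_square_altsumSr scalerBl scalerDl !mulN1r opprK.
by [].
Qed.

(** * Blades and the involution *)

(** Gives access to the generic lemmas on linear maps. *)
Lemma linear_pack (R : pzRingType) (U V : lmodType R) (f : U -> V) :
  linear f -> {g : {linear U -> V} | g = f :> (U -> V)}.
Proof.
move=> lf; pose m := GRing.isLinear.Build R U V *:%R f lf.
pose g : {linear U -> V} := HB.pack f m.
by exists g.
Qed.

Lemma involution1 (R : realType) (A : falgType R) (star : A -> A) :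
  involution star -> star 1 = 1.
Proof.
move=> [_ starM starK].
by rewrite -[LHS]mulr1 -{2}(starK 1) -starM mulr1 starK.
Qed.

Section blades_and_star.
Variables (R : realType) (A : falgType R) (star : A -> A) (s : seq A).
Hypotheses (star_inv : involution star) (os : orthonormal_family s).
Hypotheses (s_unitary : {in s, forall x, x * star x = 1}).
Hypothesis s_gen : <<1 & s>>%VS = fullv.

(** Invariance of the sum under [w |-> x w] gives [x S (a x) = S a], that is
    [S (a x) = x^* S a], for the generators; the relation passes to products. *)
Lemma sum_blade_sandwich a :
  \sum_(t <- sublists s) blade t * a * blade t =
  star a * \sum_(t <- sublists s) blade t * blade t.
Proof.
have star1 := involution1 star_inv.
case: (star_inv) => starL starM starK; have [st stE] := linear_pack starL.
pose S a := \sum_(t <- sublists s) blade t * a * blade t.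
suff SM m : forall a, S (a * m) = star m * S a.
  rewrite -[a in LHS]mul1r [LHS]SM; congr (_ * _).
  by apply: eq_bigr => t _; rewrite mulr1.
move: m; apply: (generated_algebra_ind s_gen) => [||m n Sm Sn b|x xs b].
- split=> [b|k u v Su Sv b].
    by rewrite -stE linear0 mul0r mulr0 /S big1// => t _; rewrite mulr0 mul0r.
  rewrite starL mulrDl -scalerAl -Su -Sv /S scaler_sumr -big_split/=.
  by apply: eq_bigr => t _; rewrite !mulrDr !mulrDl -!(scalerAl, scalerAr).
- by move=> b; rewrite mulr1 star1 mul1r.
- by rewrite mulrA Sn Sm starM mulrA.
- rewrite -[S b](@sum_even_blade _ _ _ (fun w => w * b * w) _ os xs); last first.
    by move=> w; rewrite !mulNr mulrN opprK.
  rewrite mulr_sumr; apply: eq_bigr => t _.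
  by rewrite !mulrA (mulr1_left (s_unitary xs)) mul1r.
Qed.

(** Summing the coordinate inner products of [a w] and [b w] over the blades [w]
    makes right multiplication by a generator orthogonal, hence right
    multiplication by [m^*] adjoint to right multiplication by [m] for all [m].
    A unitary [u] then has the same norm as 1, and the empty blade alone bounds
    the coordinates of [u] by this norm. *)
Lemma unitary_coord_bounded :
  exists K : R, forall u, unitary star u ->
    forall i, `|coord (vbasis {:A}) i u| <= K.
Proof.
have star1 := involution1 star_inv.
case: (star_inv) => starL starM starK; have [st stE] := linear_pack starL.
pose c i (a : A) := coord (vbasis {:A}) i a.
pose ip a b := \sum_(t <- sublists s) \sum_i c i (a * blade t) * c i (b * blade t).
have ipM m : forall a b, ip (a * m) b = ip a (b * star m).
  move: m; apply: (generated_algebra_ind s_gen) => [||m n ipm ipn a b|x xs a b].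
  - split=> [a b|k u v ipu ipv a b].
      rewrite -stE linear0 !mulr0 /ip !big1// => t _; rewrite big1// => i _;
        by rewrite /c mul0r linear0 ?mul0r ?mulr0.
    transitivity (k * ip (a * u) b + ip (a * v) b).
      rewrite /ip mulr_sumr -big_split/=; apply: eq_bigr => t _.
      rewrite mulr_sumr -big_split/=; apply: eq_bigr => i _.
      by rewrite /c mulrDr mulrDl -(scalerAr _ a) -scalerAl linearP/=; ring.
    rewrite ipu ipv starL /ip mulr_sumr -big_split/=; apply: eq_bigr => t _.
    rewrite mulr_sumr -big_split/=; apply: eq_bigr => i _.
    by rewrite /c mulrDr mulrDl -(scalerAr _ b) -scalerAl linearP/=; ring.
  - by move=> a b; rewrite star1 !mulr1.
  - by rewrite mulrA ipn ipm starM mulrA.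
  - have sxx := mulr1_left (s_unitary xs).
    rewrite -[b in LHS]mulr1 -sxx mulrA; move: (b * star x) => d.
    pose f w := \sum_i c i (a * w) * c i (d * w).
    rewrite /ip -(@sum_even_blade _ _ _ f _ os xs).
      by apply: eq_bigr => t _; apply: eq_bigr => i _; rewrite !mulrA.
    by move=> w; rewrite /f; apply: eq_bigr => i _; rewrite /c !mulrN !linearN mulrNN.
have ip_ge a i : c i a ^+ 2 <= ip a a.
  have nil_in : [::] \in sublists s.
    by elim: (s) => //= x s' IH; rewrite mem_cat IH.
  rewrite /ip (big_rem [::])//= (bigD1 i)//= blade_nil mulr1 -expr2 -addrA lerDl.
  apply: addr_ge0; first by apply: sumr_ge0 => j _; rewrite -expr2 sqr_ge0.
  by apply: sumr_ge0 => t _; apply: sumr_ge0 => j _; rewrite -expr2 sqr_ge0.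
(* [t^2 <= S] implies [|t| <= 1 + S]. *)
exists (1 + ip 1 1) => u uu i.
have := ip_ge u i; rewrite -[X in ip X]mul1r ipM uu -/(c i u) => cu.
by rewrite ler_norml; apply/andP; split; nra.
Qed.

End blades_and_star.

(** * The generators of a Clifford algebra *)

Section clifford_generators.
Variables (R : realType) (p q : nat) (A : falgType R) (e : 'I_(p + q) -> A).
Hypothesis cl : is_clifford e.

Lemma clifford_orthonormal : orthonormal_family (codom e).
Proof.
case: cl => _ _ pos neg anti; split.
  move=> _ /codomP[i ->]; rewrite -expr2.
  by have [/pos|/neg] := ltnP i p; [left|right].
rewrite /codom /image_mem pairwise_map.
apply: (sub_pairwise (r := fun i j => i != j)); last first.
  by rewrite -uniq_pairwise enum_uniq.
by move=> i j ij; apply/eqP/anti.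
Qed.

Lemma count_clifford :
  count (fun x => x * x == 1) (codom e) = p /\
  count (fun x => x * x == -1) (codom e) = q.
Proof.
case: cl => _ _ pos neg _.
have neq1 := oner_neqN1 A.
have posE : count (fun x => x * x == 1) (codom e) = p.
  rewrite /codom /image_mem count_map (@eq_count _ _ (fun i : 'I_(p + q) => (i < p)%N)).
    rewrite -sum1_count big_enum_cond/=.
    rewrite -(big_ord_widen_cond _ xpredT (fun=> 1%N) (leq_addr q p)).
    by rewrite sum1_card card_ord.
  move=> i /=; rewrite -expr2; have [/pos ->|/neg ->] := ltnP i p; first by rewrite eqxx.
  by rewrite eq_sym neq1.
(* The two classes of generators partition the family. *)
split=> //; apply/eqP; rewrite -(eqn_add2l p) -{1}posE; apply/eqP.
transitivity (size (codom e)); last by rewrite size_codom card_ord.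
rewrite -(count_predC (fun x => x * x == 1)); congr addn.
apply: eq_in_count => _ /codomP[i ->] /=; rewrite -expr2.
by have [/pos ->|/neg ->] := ltnP i p; rewrite ?eqxx ?neq1// eq_sym neq1.
Qed.

Lemma clifford_unitary (star : A -> A) : clifford_involution e star ->
  {in codom e, forall x, x * star x = 1}.
Proof.
case: cl => _ _ pos neg _ [_ spos sneg] _ /codomP[i ->].
have [ip|pi] := ltnP i p; first by rewrite spos// -expr2 pos.
by rewrite sneg// mulrN -expr2 neg// opprK.
Qed.

End clifford_generators.

(** * Topology of a finite-dimensional algebra *)

Lemma continuous_mulr_cst (R : realType) (T : topologicalType) (f : T -> R) c :
  continuous f -> continuous (fun t => f t * c).
Proof. by move=> cf t; apply: cvgMl; exact: cf. Qed.

Section topology.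
Variables (R : realType) (A : falgType R).
Let N := \dim {:A}.
Let b : N.-tuple A := vbasis {:A}.
Let x_ (i : 'I_N) (a : A) : R := coord b i a.

Lemma coordE (a : A) : a = \sum_i x_ i a *: b`_i.
Proof. exact: coord_vbasis (memvf a). Qed.

Lemma coord_combination (r : 'I_N -> R) k : x_ k (\sum_i r i *: b`_i) = r k.
Proof. exact/coord_sum_free/basis_free/vbasisP. Qed.

Lemma coord_inj (a a' : A) : (forall i, x_ i a = x_ i a') -> a = a'.
Proof. by move=> aa'; rewrite (coordE a) (coordE a'); under eq_bigr do rewrite aa'. Qed.

Lemma coords_inj : injective (@coords R A).
Proof. by move=> a a' /rowP aa'; apply: coord_inj => i; have := aa' i; rewrite !mxE. Qed.

Lemma coord_linear_comb (f : {linear A -> A}) a k :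
  x_ k (f a) = \sum_i x_ i a * x_ k (f b`_i).
Proof.
rewrite {1}(coordE a) linear_sum [LHS]linear_sum; apply: eq_bigr => i _.
by rewrite linearZ/= [LHS]linearZ.
Qed.

Lemma coord_mul a a' k :
  x_ k (a * a') = \sum_i \sum_j x_ i a * x_ j a' * x_ k (b`_i * b`_j).
Proof.
rewrite {1}(coordE a) mulr_suml [LHS]linear_sum; apply: eq_bigr => i _.
rewrite {1}(coordE a') mulr_sumr [LHS]linear_sum; apply: eq_bigr => j _.
by rewrite -scalerAl -scalerAr [LHS]linearZ [_ (_ *: _)]linearZ/= mulrA.
Qed.

Lemma continuous_coord i : continuous (x_ i : natural A -> R).
Proof.
have -> : x_ i = (fun M : 'rV[R]_N => M 0 i) \o @coords R A.
  by apply/funext => a /=; rewrite mxE.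
move=> a; apply: continuous_comp; first exact: initial_continuous.
exact: coord_continuous.
Qed.

(** Neighbourhoods in a space of matrices are boxes, so continuity into the
    algebra can be tested on coordinates. *)
Lemma continuous_naturalP (T : topologicalType) (F : T -> natural A) :
  (forall i, continuous (fun t => x_ i (F t))) -> continuous F.
Proof.
move=> cF; apply: continuous_comp_initial => t B [P Pt PB].
have near_all : \forall u \near t, forall i j, P i j (x_ j (F u)).
  apply: filter_forall => i; apply: filter_forall => j.
  by apply: (cF j t); have := Pt i j; rewrite mxE.
by apply: filterS near_all => u Pu; apply: PB => i j; rewrite mxE; exact: Pu.
Qed.

Lemma continuous_sumr (T : topologicalType) (I : Type) (r : seq I)
    (f : I -> T -> R) :
  (forall i, continuous (f i)) -> continuous (fun t => \sum_(i <- r) f i t).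
Proof. by move=> cf; apply: continuous_big => // -[u v]; exact: add_continuous. Qed.

Lemma continuous_natural_mul (T : topologicalType) (F H : T -> natural A) :
  continuous F -> continuous H ->
  continuous ((fun t => (F t : A) * (H t : A)) : T -> natural A).
Proof.
move=> cF cH; apply: continuous_naturalP => k.
under eq_fun do rewrite coord_mul.
apply: continuous_sumr => i; apply: continuous_sumr => j t.
apply: cvgMl; apply: cvgM.
  exact: (continuous_comp (@cF t) (@continuous_coord i _)).
exact: (continuous_comp (@cH t) (@continuous_coord j _)).
Qed.

Lemma continuous_natural_linear (T : topologicalType) (F : T -> natural A)
    (f : {linear A -> A}) :
  continuous F -> continuous ((fun t => f (F t : A)) : T -> natural A).
Proof.
move=> cF; apply: continuous_naturalP => k.
under eq_fun do rewrite coord_linear_comb.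
apply: continuous_sumr => i t; apply: cvgMl.
exact: (continuous_comp (@cF t) (@continuous_coord i _)).
Qed.

Lemma continuous_natural_add (T : topologicalType) (F H : T -> natural A) :
  continuous F -> continuous H ->
  continuous ((fun t => (F t : A) + (H t : A)) : T -> natural A).
Proof.
move=> cF cH; apply: continuous_naturalP => k.
under eq_fun do rewrite /x_ linearD.
move=> t; apply: cvgD.
  exact: (continuous_comp (@cF t) (@continuous_coord k _)).
exact: (continuous_comp (@cH t) (@continuous_coord k _)).
Qed.

Lemma continuous_id_natural : continuous (id : natural A -> natural A).
Proof. by move=> a; exact: cvg_id. Qed.

(** The coordinate map embeds the algebra into a Hausdorff space. *)
Lemma closed_natural1 (a : A) : closed ([set a] : set (natural A)).
Proof.
have -> : [set a] = @coords R A @^-1` [set coords a].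
  by apply/seteqP; split=> [c ->//|c /coords_inj].
apply: closed_comp; first by move=> c _; exact: initial_continuous.
by apply: accessible_closed_set1; apply: hausdorff_accessible; exact: norm_hausdorff.
Qed.

Lemma compact_measurable (G : set A) :
  compact (G : set (natural A)) -> measurable (G : set (borel A)).
Proof.
move=> cG.
have -> : G = @coords R A @^-1` (@coords R A @` G).
  by apply/seteqP; split=> [a Ga|a [c Gc /coords_inj <-]//]; exists a.
rewrite -[X in measurable X]setCK; apply: measurableC; apply: sub_sigma_algebra.
rewrite preimage_setC; apply: (open_comp (f := @coords R A : natural A -> _)).
  by move=> c _; exact: initial_continuous.
apply: closed_openC; apply: compact_closed; first exact: norm_hausdorff.
apply: (@continuous_compact (natural A) _ (@coords R A)) => //.
by apply: continuous_subspaceT; exact: initial_continuous.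
Qed.

Lemma continuous_measurable_natural (F : natural A -> natural A) :
  continuous F -> measurable_fun setT (F : borel A -> borel A).
Proof.
move=> /continuousP cF.
apply: (@measurability _ _ (borel A) (borel A) _ F (@open (natural A))) => //.
move=> _ [B oB <-]; rewrite setTI; apply: sub_sigma_algebra; exact: cF.
Qed.

Lemma continuous_measurable_real (f : natural A -> R) :
  continuous f -> measurable_fun setT (f : borel A -> R).
Proof.
move=> /continuousP cf; apply: (measurability _ (RGenOpens.measurableE R)).
move=> _ [_ [u [v ->]] <-]; rewrite setTI; apply: sub_sigma_algebra.
by apply: cf; exact: interval_open.
Qed.

(** Such a set is closed in the image of a cube under the continuous map which
    sends coordinates to vectors. *)
Lemma compact_coord_bounded (K : R) (G : set A) :
  closed (G : set (natural A)) -> (forall a, G a -> forall i, `|x_ i a| <= K) ->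
  compact (G : set (natural A)).
Proof.
move=> clG GK.
pose vec (r : 'rV[R]_N) : natural A := \sum_i r 0 i *: b`_i.
have cvec : continuous vec.
  apply: continuous_naturalP => i; under eq_fun do rewrite coord_combination.
  exact: coord_continuous.
pose cube : set 'rV[R]_N := [set r | forall i, `[- K, K]%classic (r 0 i)].
apply: (@subclosed_compact _ _ (vec @` cube)) => //.
  apply: continuous_compact; first exact: continuous_subspaceT.
  by apply: (@rV_compact _ _ (fun=> `[- K, K]%classic)) => _; exact: segment_compact.
move=> a Ga; exists (coords a) => /=.
  by move=> i; rewrite mxE/= in_itv/= -ler_norml; exact: GK.
by rewrite [RHS]coordE; apply: eq_bigr => i _; rewrite mxE.
Qed.

End topology.

(** * Integration of continuous functions over a compact set *)

Definition natural_continuous (R : realType) (A : falgType R) (F : A -> A) : Prop :=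
  continuous (F : natural A -> natural A).

Lemma natural_continuous_cst (R : realType) (A : falgType R) (a : A) :
  natural_continuous (fun=> a).
Proof. exact: (@cst_continuous (natural A) (natural A) a). Qed.

Lemma natural_continuousM (R : realType) (A : falgType R) (F H : A -> A) :
  natural_continuous F -> natural_continuous H ->
  natural_continuous (fun g => F g * H g).
Proof. exact: continuous_natural_mul. Qed.

Lemma natural_continuousD (R : realType) (A : falgType R) (F H : A -> A) :
  natural_continuous F -> natural_continuous H ->
  natural_continuous (fun g => F g + H g).
Proof. exact: continuous_natural_add. Qed.

Lemma natural_continuousZ (R : realType) (A : falgType R) k (F : A -> A) :
  natural_continuous F -> natural_continuous (fun g => k *: F g).
Proof.
move=> cF; under eq_fun do rewrite -mulr_algl.
by apply: natural_continuousM => //; exact: natural_continuous_cst.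
Qed.

Lemma natural_continuous_mull (R : realType) (A : falgType R) (h : A) :
  natural_continuous ( *%R h).
Proof.
apply: natural_continuousM; first exact: natural_continuous_cst.
exact: continuous_id_natural.
Qed.

Lemma natural_continuous_translate (R : realType) (A : falgType R) h (F : A -> A) :
  natural_continuous F -> natural_continuous (fun g => F (h * g)).
Proof.
move=> cF a; have ch := @natural_continuous_mull _ _ h.
exact: (continuous_comp (@ch a) (@cF _)).
Qed.

Section integration.
Variables (R : realType) (A : falgType R) (mu : probability (borel A) R).
Variable G : set A.
Hypotheses (cG : compact (G : set (natural A))) (muG : mu G = 1%E).
Let N := \dim {:A}.
Let b : N.-tuple A := vbasis {:A}.
Let x_ (i : 'I_N) (a : A) : R := coord b i a.
Let mG : measurable (G : set (borel A)) := compact_measurable cG.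

Lemma continuous_integrable (f : natural A -> R) :
  continuous f -> mu.-integrable (G : set (borel A)) (EFin \o f).
Proof.
move=> cf; apply: measurable_bounded_integrable => //.
- by rewrite [X in (X < _)%E]muG ltry.
- by apply: measurable_funTS; exact: (continuous_measurable_real cf).
- have /compact_bounded[M [Mr GM]] : compact (f @` (G : set (natural A))).
    by apply: (@continuous_compact (natural A)) => //; exact: continuous_subspaceT.
  by exists M; split=> // y My a Ga; apply: GM => //; exists a.
Qed.

Lemma coord_natural_continuous F i : natural_continuous F ->
  continuous ((fun a => x_ i (F a)) : natural A -> R).
Proof.
by move=> cF a; apply: (continuous_comp (@cF a) (@continuous_coord _ _ i _)).
Qed.

Lemma coord_vintegral F k :
  x_ k (vintegral mu G F) = \int[mu]_(g in (G : set (borel A))) x_ k (F g).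
Proof. exact: coord_combination. Qed.

Lemma eq_vintegral F H : (forall g, G g -> F g = H g) ->
  vintegral mu G F = vintegral mu G H.
Proof.
move=> FH; apply: eq_bigr => i _; congr (_ *: _).
by apply: eq_Rintegral => g /set_mem/FH ->.
Qed.

Lemma Rintegral_sum (n : nat) (f : 'I_n -> natural A -> R) :
  (forall i, continuous (f i)) ->
  \int[mu]_(g in (G : set (borel A))) (\sum_i f i g) =
  \sum_i \int[mu]_(g in (G : set (borel A))) f i g.
Proof.
elim: n f => [|n IH] f cf.
  under eq_Rintegral do rewrite big_ord0.
  by rewrite big_ord0 Rintegral_cst// mul0r.
under eq_Rintegral do rewrite big_ord_recl.
rewrite RintegralD//; [|exact: continuous_integrable|].
- by rewrite big_ord_recl IH// => i; exact: cf.
- by apply: continuous_integrable; apply: continuous_sumr => i; exact: cf.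
Qed.

Lemma vintegral_linear (L : {linear A -> A}) F : natural_continuous F ->
  vintegral mu G (fun g => L (F g)) = L (vintegral mu G F).
Proof.
move=> cF; apply: coord_inj => k.
rewrite [LHS]coord_vintegral [RHS]coord_linear_comb.
under eq_Rintegral do rewrite [x_ k _]coord_linear_comb.
have ci i := continuous_integrable (coord_natural_continuous (i := i) cF).
rewrite (Rintegral_sum (f := fun i g => x_ i (F g) * x_ k (L b`_i))); last first.
  move=> i; apply: (@continuous_mulr_cst _ (natural A)).
  exact: (coord_natural_continuous (i := i) cF).
apply: eq_bigr => i _; rewrite RintegralZr//; congr (_ * _).
exact/esym/coord_vintegral.
Qed.

Lemma vintegralMl h F : natural_continuous F ->
  vintegral mu G (fun g => h * F g) = h * vintegral mu G F.
Proof.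
move=> cF; transitivity (amull h (vintegral mu G F)); last by rewrite /amull lfunE.
by rewrite -vintegral_linear//; apply: eq_vintegral => g _; rewrite /= /amull lfunE.
Qed.

Lemma vintegralMr h F : natural_continuous F ->
  vintegral mu G (fun g => F g * h) = vintegral mu G F * h.
Proof.
move=> cF; transitivity (amulr h (vintegral mu G F)); last by rewrite /amulr lfunE.
by rewrite -vintegral_linear//; apply: eq_vintegral => g _; rewrite /= /amulr lfunE.
Qed.

Lemma vintegralZ k F : natural_continuous F ->
  vintegral mu G (fun g => k *: F g) = k *: vintegral mu G F.
Proof.
move=> cF; rewrite -[RHS]mulr_algl -vintegralMl//.
by apply: eq_vintegral => g _; rewrite mulr_algl.
Qed.

Lemma vintegralD F H : natural_continuous F -> natural_continuous H ->
  vintegral mu G (fun g => F g + H g) = vintegral mu G F + vintegral mu G H.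
Proof.
move=> cF cH; apply: coord_inj => k.
rewrite [coord _ _ _]coord_vintegral linearD/=.
rewrite ![coord _ _ (vintegral _ _ _)]coord_vintegral.
rewrite -RintegralD//; last 2 first.
- exact: (continuous_integrable (coord_natural_continuous (i := k) cF)).
- exact: (continuous_integrable (coord_natural_continuous (i := k) cH)).
by apply: eq_Rintegral => g _; rewrite /x_ linearD.
Qed.

Lemma vintegral_cst a : vintegral mu G (fun=> a) = a.
Proof.
apply: coord_inj => k; rewrite [LHS]coord_vintegral Rintegral_cst//.
by rewrite [X in fine X]muG mulr1.
Qed.

Lemma vintegral_sum (I : Type) (r : seq I) (F : I -> A -> A) :
  (forall i, natural_continuous (F i)) ->
  vintegral mu G (fun g => \sum_(i <- r) F i g) = \sum_(i <- r) vintegral mu G (F i).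
Proof.
move=> cF; suff [] : vintegral mu G (fun g => \sum_(i <- r) F i g) =
    \sum_(i <- r) vintegral mu G (F i) /\
    natural_continuous (fun g => \sum_(i <- r) F i g) by [].
elim: r => [|i r [IH cr]].
  rewrite (_ : (fun g => _) = fun=> 0); last by apply/funext => g; rewrite big_nil.
  by rewrite big_nil vintegral_cst; split=> //; exact: natural_continuous_cst.
rewrite (_ : (fun g => _) = fun g => F i g + \sum_(j <- r) F j g); last first.
  by apply/funext => g; rewrite big_cons.
rewrite big_cons vintegralD// IH; split=> //.
exact: (@continuous_natural_add _ _ (natural A)) (cF i) cr.
Qed.

(** Change of variables along [g |-> h g], which maps [G] onto itself and preserves
    the measure. *)
Lemma vintegral_translate h F :
  (forall B : set (borel A), measurable B ->
    mu ((fun g : A => h * g) @^-1` B) = mu B) ->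
  (forall g, G (h * g) <-> G g) -> natural_continuous F ->
  vintegral mu G (fun g => F (h * g)) = vintegral mu G F.
Proof.
move=> inv hG cF; apply: eq_bigr => k _; congr (_ *: _); rewrite /Rintegral.
have ch := @natural_continuous_mull _ _ h.
have mh : measurable_fun setT ( *%R h : borel A -> borel A).
  exact: continuous_measurable_natural.
have GE : (fun g : A => h * g) @^-1` G = G by apply/seteqP; split=> g /hG.
congr fine; rewrite -[in LHS]GE.
pose f : borel A -> \bar R := EFin \o (fun g => x_ k (F g)).
have cf := coord_natural_continuous (i := k) cF.
pose lh : borel A -> borel A := *%R h.
have <- : (\int[pushforward mu lh]_(g in (G : set (borel A))) f g =
    \int[mu]_(g in ( *%R h) @^-1` G) (f \o *%R h) g)%E.
  apply: integral_pushforward => //.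
    by apply/measurable_EFinP; exact: continuous_measurable_real.
  rewrite GE; apply: (continuous_integrable (f := fun g => x_ k (F (h * g)))).
  by move=> a; apply: (continuous_comp (@ch a) (@cf _)).
by apply: eq_measure_integral => B mB _; exact: inv.
Qed.

End integration.

(** * Averaging over a polarizing group *)

Lemma unitary_unit (R : realType) (A : falgType R) (star : A -> A) u :
  unitary star u -> u \is a GRing.unit.
Proof. by move=> uu; apply/unitrP; exists (star u); split=> //; exact: mulr1_left. Qed.

Lemma blade_unitary (R : realType) (A : falgType R) (star : A -> A) t :
  involution star -> {in t, forall x, x * star x = 1} ->
  blade t * star (blade t) = 1.
Proof.
move=> star_inv; elim: t => [|x t IH] xx.
  by rewrite blade_nil mul1r; exact: involution1.
rewrite blade_cons involutionM// mulrA -[x * _ * _]mulrA IH ?mulr1 ?xx ?mem_head//.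
by move=> y yt; rewrite xx// inE yt orbT.
Qed.

Section averaging.
Variables (R : realType) (A : falgType R) (star : A -> A).
Variables (G : set A) (mu : probability (borel A) R).
Hypotheses (star_inv : involution star) (pol : polarizing star G mu).

Let cG : compact (G : set (natural A)) := polarizing_compact pol.
Let muG : mu G = 1%E := is_haar_carried (polarizing_haar pol).

Let sandwich_continuous (a c : A) :
  natural_continuous (fun g : A => g * a * c * g).
Proof.
apply: natural_continuousM; last exact: continuous_id_natural.
apply: natural_continuousM; last exact: natural_continuous_cst.
apply: natural_continuousM; last exact: natural_continuous_cst.
exact: continuous_id_natural.
Qed.

Definition haar_sandwich a : A := vintegral mu G (fun g => g * a * g).

(** For [h] in [G], substituting [h g] for [g] gives [T a = h T (a h)], and [h^*] is
    the inverse of [h].  Both sides are linear in [h], and [G] spans the algebra. *)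
Lemma haar_sandwichM a h : haar_sandwich (a * h) = star h * haar_sandwich a.
Proof.
case: (star_inv) => starL starM starK; have [st stE] := linear_pack starL.
have [subG _ gen haar _] := pol; have [GU G1 GM GV] := subG.
move: h a; apply: (generates_ind star_inv subG gen) => [|h Gh a].
  split=> [a|k u v Tu Tv a].
    rewrite mulr0 -stE linear0 mul0r -[RHS](vintegral_cst cG muG).
    by apply: eq_vintegral => g _; rewrite mulr0 mul0r.
  rewrite starL mulrDl -scalerAl -Tu -Tv.
  have cs c : natural_continuous (fun g : A => g * (a * c) * g).
    by under eq_fun do rewrite mulrA; exact: sandwich_continuous.
  rewrite -vintegralZ// -vintegralD//; last first.
    exact: natural_continuousZ.
  apply: eq_vintegral => g _.
  by rewrite !mulrDr mulrDl -scalerAr -(scalerAr _ g) -scalerAl.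
have hu : h \is a GRing.unit := unitary_unit (GU _ Gh).
have hG g : G (h * g) <-> G g.
  split=> [Ghg|]; last exact: GM.
  by rewrite -(mulKr hu g); apply: GM => //; exact: GV.
have cs c : natural_continuous (fun g : A => g * c * g).
  have := @sandwich_continuous c 1; rewrite /natural_continuous.
  by under eq_fun do rewrite mulr1.
rewrite -[haar_sandwich a](vintegral_translate cG muG _ hG)//; last first.
  by move=> B mB; exact: is_haar_invariant haar _ _ Gh mB.
rewrite -[RHS](vintegralMl cG muG); last first.
  exact: (@natural_continuous_translate _ _ h (fun g => g * a * g)).
have sh : star h * h = 1 := mulr1_left (GU _ Gh).
by apply: eq_vintegral => g _; rewrite !mulrA sh mul1r.
Qed.

(** Compute the sum of the [w T (a w)] over the blades [w] in two ways: each term is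
    [T a]; and, inside the integral, the blades produce [C (g a)^* g = C a^*]. *)
Lemma haar_sandwichE (s : seq A) C :
  orthonormal_family s -> {in s, forall x, x * star x = 1} ->
  <<1 & s>>%VS = fullv ->
  \sum_(t <- sublists s) blade t * blade t = C%:A ->
  forall a, haar_sandwich a = (C / 2 ^+ size s) *: star a.
Proof.
move=> os su sgen sumC a; have [subG _ _ _ _] := pol.
case: (star_inv) => starL starM starK; have [st stE] := linear_pack starL.
have avg : \sum_(t <- sublists s) blade t * haar_sandwich (a * blade t) = C *: star a.
  transitivity (vintegral mu G (fun g =>
      \sum_(t <- sublists s) blade t * (g * a * blade t * g))).
    rewrite vintegral_sum//; last first.
      move=> t; apply: natural_continuousM; last exact: sandwich_continuous.
      exact: natural_continuous_cst.
    apply: eq_bigr => t _.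
    rewrite vintegralMl//; congr (_ * _).
    by apply: eq_vintegral => g _; rewrite mulrA.
  rewrite -[RHS](vintegral_cst cG muG); apply: eq_vintegral => g Gg.
  transitivity ((\sum_(t <- sublists s) blade t * (g * a) * blade t) * g).
    by rewrite mulr_suml; apply: eq_bigr => t _; rewrite !mulrA.
  rewrite (sum_blade_sandwich star_inv)// sumC mulr_algr -scalerAl starM -mulrA.
  have /mulr1_left -> : g * star g = 1 := unitary_subgroup_sub subG Gg.
  by rewrite mulr1.
have : (2 ^+ size s) *: haar_sandwich a = C *: star a.
  rewrite -avg; transitivity (\sum_(t <- sublists s) haar_sandwich a).
    by rewrite big_const_seq count_predT size_sublists iter_addr_0 -natrX scaler_nat.
  rewrite big_seq [RHS]big_seq; apply: eq_bigr => t ts.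
  rewrite haar_sandwichM mulrA blade_unitary ?mul1r// => x xt.
  by apply: su; exact: (mem_sublists ts).
move=> /(congr1 ( *:%R (2 ^+ size s)^-1)).
by rewrite !scalerA mulVf ?expf_neq0 ?pnatr_eq0// scale1r mulrC.
Qed.

End averaging.

(** The outer terms [Q(x,x) g] and [g Q(y,y)] of the expansion vanish since the
    identity has mean zero; the unitarity of [g] cancels it from [Q(x,y) g^* g]. *)
Lemma hermitian_average (R : realType) (A : falgType R) (star : A -> A)
    (X : lmodType A) (Q : X -> X -> A) (G : set A) (mu : probability (borel A) R) :
  involution star -> hermitian_form star Q -> polarizing star G mu -> forall x y,
  vintegral mu G (fun g => Q (x + g *: y) (x + g *: y) * g) =
  Q x y + haar_sandwich G mu (Q y x).
Proof.
move=> [starL starM starK] [QD QZ Qst] [subG cG _ haar mean0] x y.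
have [st stE] := linear_pack starL; have muG := is_haar_carried haar.
have Qr g v : Q v (x + g *: y) = Q v x + Q v y * star g.
  by rewrite -Qst QD QZ -stE linearD/= stE starM !Qst.
have cid : natural_continuous (fun g : A => g) by exact: continuous_id_natural.
have cst (a : A) := @natural_continuous_cst _ _ a.
rewrite (@eq_vintegral _ _ _ _ _
    (fun g => Q x x * g + g * Q y y + (Q x y + g * Q y x * g))); last first.
  move=> g /(unitary_subgroup_sub subG)/mulr1_left gg.
  rewrite QD QZ !Qr !(mulrDl, mulrDr) -!mulrA gg !mulr1.
  by rewrite -!addrA; congr (_ + _); rewrite addrA addrC.
have cM := @natural_continuousM R A.
have cD := @natural_continuousD R A.
have c1 : natural_continuous (fun g : A => Q x x * g) by exact: cM.
have c2 : natural_continuous (fun g : A => g * Q y y) by exact: cM.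
have c0 : natural_continuous (fun g : A => g * Q y x) by exact: cM.
have c3 : natural_continuous (fun g : A => g * Q y x * g) := cM _ _ c0 cid.
rewrite vintegralD; [|by []|by []|exact: cD|exact: cD].
rewrite !vintegralD//.
by rewrite vintegralMl// vintegralMr// mean0 mulr0 mul0r !add0r vintegral_cst.
Qed.

(** * The group of signed blades *)

Definition signed_blades (A : nzRingType) (s : seq A) : set A :=
  [set g | exists2 t, t \in sublists s & g = blade t \/ g = - blade t].

Lemma nil_sublists (T : eqType) (s : seq T) : [::] \in sublists s.
Proof. by elim: s => //= x s IH; rewrite mem_cat IH. Qed.

Section signed_blades.
Variables (A : unitRingType) (s : seq A).
Hypothesis os : orthonormal_family s.

Lemma signed_bladesN g : signed_blades s g -> signed_blades s (- g).
Proof. by move=> [t ts [->|->]]; exists t => //; [right|left; rewrite opprK]. Qed.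

Lemma signed_blades1 : signed_blades s 1.
Proof. by exists [::]; rewrite ?nil_sublists ?blade_nil; [|left]. Qed.

Lemma signed_blades_mull x g : x \in s -> signed_blades s g -> signed_blades s (x * g).
Proof.
move=> xs [t ts gE]; have [t' t's tE] := mul_generator_blade os xs ts.
suff : signed_blades s (x * blade t).
  by case: gE => -> // /signed_bladesN; rewrite mulrN.
by exists t'.
Qed.

Lemma signed_blades_generator x : x \in s -> signed_blades s x.
Proof.
rewrite -{2}[x]mulr1 => xs.
by apply: signed_blades_mull => //; exact: signed_blades1.
Qed.

Lemma signed_bladesM g h :
  signed_blades s g -> signed_blades s h -> signed_blades s (g * h).
Proof.
move=> [t /mem_sublists ts gE] sh; suff sth : signed_blades s (blade t * h).
  by case: gE => ->//; rewrite mulNr; exact: signed_bladesN.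
elim: t ts {gE} => [|x t IH] ts; first by rewrite blade_nil mul1r.
rewrite blade_cons -mulrA; apply: signed_blades_mull; first by rewrite ts ?mem_head.
by apply: IH => y yt; apply: ts; rewrite inE yt orbT.
Qed.

Lemma signed_bladesV g : signed_blades s g -> signed_blades s g^-1.
Proof.
move=> [t /mem_sublists ts gE].
suff [_ st] : blade t \is a GRing.unit /\ signed_blades s (blade t)^-1.
  by case: gE => ->//; rewrite invrN; exact: signed_bladesN.
elim: t ts {gE} => [|x t IH] ts.
  by rewrite blade_nil invr1 unitr1; split=> //; exact: signed_blades1.
have [|ut st] := IH; first by move=> y yt; apply: ts; rewrite inE yt orbT.
have xs : x \in s by rewrite ts ?mem_head.
have xx := orthonormal_sqr os xs.
have [ux sx] : x \is a GRing.unit /\ signed_blades s x^-1.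
  have sx := signed_blades_generator xs.
  have [y [xy yx] sy] : exists2 y, x * y = 1 /\ y * x = 1 & signed_blades s y.
    case: xx => xx; first by exists x.
    by exists (- x); [rewrite mulrN mulNr xx opprK|exact: signed_bladesN].
  have ux : x \is a GRing.unit by apply/unitrP; exists y.
  by split=> //; suff -> : x^-1 = y by []; rewrite -[LHS]mulr1 -xy mulKr.
by rewrite blade_cons unitrMl// invrM//; split=> //; exact: signed_bladesM.
Qed.

Lemma sum_even_signed_blade (V : nmodType) (f : A -> V) h :
  signed_blades s h -> (forall a, f (- a) = f a) ->
  \sum_(t <- sublists s) f (h * blade t) = \sum_(t <- sublists s) f (blade t).
Proof.
move=> [u /mem_sublists us hE] f_even.
transitivity (\sum_(t <- sublists s) f (blade u * blade t)).
  by apply: eq_bigr => t _; case: hE => ->//; rewrite mulNr f_even.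
elim: u us f f_even {hE} => [|x u IH] us f f_even.
  by apply: eq_bigr => t _; rewrite blade_nil mul1r.
have xs : x \in s by rewrite us ?mem_head.
rewrite -(sum_even_blade os xs f_even) -(IH _ (fun a => f (x * a))).
- by apply: eq_bigr => t _; rewrite blade_cons mulrA.
- by move=> y yu; apply: us; rewrite inE yu orbT.
- by move=> a; rewrite mulrN f_even.
Qed.

Lemma finite_signed_blades : finite_set (signed_blades s).
Proof.
pose l := map (@blade A) (sublists s).
apply: (@sub_finite_set _ _ [set` l ++ map -%R l]); last exact: finite_seq.
move=> _ [t ts [->|->]] /=; rewrite mem_cat.
  by rewrite map_f.
by apply/orP; right; exact/map_f/map_f.
Qed.

End signed_blades.

(** The normalized sum of the Dirac masses at the entries of [l]. *)
Lemma exists_uniform_probability d (T : measurableType d) (R : realType) (l : seq T) :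
  (0 < size l)%N -> exists mu : probability T R, forall B : set T,
    mu B = (\sum_(a <- l) \1_B a / (size l)%:R)%:E.
Proof.
case: l => // a0 l' _; set l := a0 :: l'.
have [m mE] : exists m : {measure set T -> \bar R},
    forall B, m B = (\sum_(a <- l) \1_B a)%:E.
  exists (msum (fun k => @dirac _ T (nth a0 l k) R) (size l)) => B.
  by rewrite /= /msum (big_nth a0) big_mkord sumEFin.
have mT : m setT = (size l)%:R%:E.
  rewrite mE; congr _%:E; under eq_bigr do rewrite indicT.
  by rewrite big_const_seq count_predT iter_addr_0.
suff mnE B : mnormalize m (@dirac _ T a0 R) B =
    (\sum_(a <- l) \1_B a / (size l)%:R)%:E.
  by exists (mnormalize m (@dirac _ T a0 R)).
rewrite /mnormalize mT; case: ifPn => [|_]; first by rewrite eqe pnatr_eq0.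
by rewrite mE -EFinM mulr_suml.
Qed.

(** The uniform measure on the signed blades is invariant because the number of
    signs [b] with [b w] in a given set is an even function of [w].  It has mean
    zero because it is invariant under -1. *)
Lemma signed_blades_polarizing (R : realType) (A : falgType R) (star : A -> A)
    (s : seq A) :
  involution star -> orthonormal_family s -> {in s, forall x, x * star x = 1} ->
  <<1 & s>>%VS = fullv ->
  exists mu : probability (borel A) R, polarizing star (signed_blades s) mu.
Proof.
move=> star_inv os su sgen.
case: (star_inv) => starL starM starK; have [st stE] := linear_pack starL.
pose ws := map (@blade A) (sublists s).
have [|mu muE] := @exists_uniform_probability _ (borel A) R (ws ++ map -%R ws).
  by rewrite size_cat size_map size_map size_sublists addn_gt0 expn_gt0.
have {}muE (B : set (borel A)) : mu B =
    (\sum_(t <- sublists s) (\1_B (blade t) + \1_B (- blade t)) /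
     (size (ws ++ map -%R ws))%:R)%:E.
  rewrite muE big_cat/= !big_map -big_split/=; congr _%:E.
  by apply: eq_bigr => t _; rewrite -mulrDl.
have haar : is_haar (signed_blades s) mu.
  split=> [|g B Gg mB].
    rewrite -(probability_setT mu) !muE; congr _%:E.
    rewrite big_seq [RHS]big_seq; apply: eq_bigr => t ts.
    have tG : signed_blades s (blade t) by exists t => //; left.
    by rewrite !indicE !mem_set//; exact: signed_bladesN.
  rewrite !muE; congr _%:E; rewrite -!mulr_suml; congr (_ / _).
  rewrite -(@sum_even_signed_blade _ _ os _
    (fun a => \1_B (a : borel A) + \1_B (- a : borel A) : R) _ Gg).
    apply: eq_bigr => t _; by rewrite -mulrN !indicE.
  by move=> a; rewrite opprK addrC.
have subG : unitary_subgroup star (signed_blades s).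
  split.
  - move=> g [t /mem_sublists ts tE]; rewrite /unitary/=.
    have bb : blade t * star (blade t) = 1.
      by apply: blade_unitary => // x /ts; exact: su.
    by case: tE => ->; rewrite // -stE linearN stE mulrNN.
  - exact: signed_blades1.
  - by move=> g h; exact: signed_bladesM.
  - by move=> g; exact: signed_bladesV.
have cG : compact (signed_blades s : set (natural A)).
  by apply: finite_compact; exact: finite_signed_blades.
exists mu; split=> //.
  by apply: (generates_of_generators sgen) => x; exact: signed_blades_generator.
(* Translation by -1 shows that the mean is its own opposite. *)
have GN1 : signed_blades s (-1) by apply: signed_bladesN; exact: signed_blades1.
have muG := is_haar_carried haar.
have cid : natural_continuous (fun g : A => g) by exact: continuous_id_natural.
have hG g : signed_blades s (-1 * g) <-> signed_blades s g.
  by rewrite mulN1r; split=> /signed_bladesN //; rewrite opprK.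
have := @vintegral_translate _ _ mu _ cG muG (-1) _ _ hG cid.
move=> /(_ (fun B mB => is_haar_invariant haar GN1 mB)).
rewrite vintegralMl// mulN1r => /eqP; rewrite -subr_eq0 -opprD oppr_eq0.
by rewrite -mulr2n -scaler_nat scaler_eq0 pnatr_eq0/= => /eqP.
Qed.

Lemma polarizable_of_unitary_generators (R : realType) (A : falgType R) (star : A -> A)
    (s : seq A) :
  involution star -> orthonormal_family s -> {in s, forall x, x * star x = 1} ->
  <<1 & s>>%VS = fullv -> polarizable star.
Proof.
move=> star_inv os su sgen.
case: (star_inv) => starL starM starK; have [st stE] := linear_pack starL.
split; last exact: generates_of_generators sgen su.
have [K UK] := unitary_coord_bounded star_inv os su sgen.
apply: (compact_coord_bounded (K := K)) => //.
pose f (u : natural A) : natural A := (u : A) * st (u : A).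
have -> : unitary star = f @^-1` [set 1].
  by apply/seteqP; split=> u; rewrite /unitary/= /f stE.
apply: (@closed_comp (natural A) (natural A)); last exact: closed_natural1.
move=> u _; apply: (@continuous_natural_mul _ _ (natural A)).
  exact: continuous_id_natural.
exact: (continuous_natural_linear (f := st) (@continuous_id_natural R A)).
Qed.

(** * The polarization constant *)

Lemma blade_square_mean (R : realType) (p q : nat) :
  blade_square_sum R p q / 2 ^+ (p + q) =
  2 `^ (- (((p + q)%:R - 1) / 2)) * cos ((p%:R - q%:R - 1) / 4 * pi).
Proof.
rewrite /blade_square_sum mulrAC; congr (_ * _).
have n2 : 2 ^+ (p + q) != 0 :> R by rewrite expf_neq0// pnatr_eq0.
apply: (mulIf n2); rewrite divfK//.
rewrite -powR12_sqrt// -!powR_mulrn ?powR_ge0// -powRrM -powRD; last first.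
  by rewrite pnatr_eq0 implybT.
by congr (_ `^ _); rewrite -natr1; field.
Qed.

Theorem proposition5p5 (R : realType) (p q : nat) (A : falgType R)
    (e : 'I_(p + q) -> A) (star : A -> A) :
  is_clifford e -> clifford_involution e star ->
  forall kappa : A,
    is_polarization_constant star kappa <->
    kappa =
      ((1 + 2 `^ (- (((p + q)%:R - 1) / 2))
            * cos ((p%:R - q%:R - 1) / 4 * pi))^-1)%:A.
Proof.
move=> cl cst kappa; rewrite -blade_square_mean; set c := _ / 2 ^+ _.
have star_inv := clifford_involution_inv cst.
have os := clifford_orthonormal cl; have su := clifford_unitary cl cst.
have sgen := clifford_generated cl; have [cp cq] := count_clifford cl.
have c1 : 1 + c != 0.
  rewrite lt0r_neq0//; have [+ _ _] := blade_square_sum_bounds R p q.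
  by rewrite -ltrBlDl sub0r ltr_pdivlMr ?exprn_gt0// mulN1r.
have average (X : lmodType A) (Q : X -> X -> A) G mu x y :
    hermitian_form star Q -> polarizing star G mu ->
    vintegral mu G (fun g => Q (x + g *: y) (x + g *: y) * g) = (1 + c) *: Q x y.
  move=> herm pol; rewrite (hermitian_average star_inv herm pol).
  have [sumE _] := sum_blade_sqr os; rewrite cp cq in sumE.
  rewrite (haar_sandwichE star_inv pol os su sgen sumE) (hermitian_form_star herm).
  by rewrite size_codom card_ord scalerDl scale1r.
split=> [[_ kappaP]|->]; last first.
  split=> [|X Q G mu herm pol x y].
    exact: polarizable_of_unitary_generators star_inv os su sgen.
  by rewrite average// mulr_algl scalerA mulVf// scale1r.
have [mu pol] := signed_blades_polarizing star_inv os su sgen.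
(* The form [x y^*] on the regular module, at [x = y = 1], determines [kappa]. *)
pose Q (x y : A^o) : A := x * star y.
have [starL starM starK] := star_inv.
have herm : hermitian_form star Q.
  split=> [x y z|a x y|x y]; rewrite /Q; first exact: mulrDl.
    exact: esym (mulrA _ _ _).
  by rewrite starM starK.
have := kappaP A^o Q _ mu herm pol 1 1.
rewrite average// /Q mul1r (involution1 star_inv) -scalerAr mulr1 => k1.
suff -> : kappa = (1 + c)^-1 *: ((1 + c) *: kappa) by rewrite -k1.
by rewrite scalerA mulVf// scale1r.
Qed.
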